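(* Let $\gamma>0$, let $\hat r_n(\gamma)$ be defined by $\hat r_n(\gamma)^d = \frac{\gamma\log n}{\alpha n}$, and let $L_n(\gamma)$ be the length of the longest edge in the graph $G_n(\hat r_n(\gamma))$. If $g(r) = o(e^{-cr})$ as $r\to\infty$ for some $c>0$, then almost surely $$\limsup_{n\to\infty} \frac{L_n(\gamma)}{\hat r_n(\gamma)\log n} \le \frac1c.$$ If $g(r) = o(r^{-c})$ as $r\to\infty$ for some $c>2d$, then almost surely $$\limsup_{n\to\infty} \frac{\log L_n(\gamma)}{\log n} \le -\frac{c-2d}{d(c-d)}.$$
   Context: Let $d \ge 2$ and $S = \left(-\frac12,\frac12\right]^d$, equipped with the toroidal metric $d(x,y) = \inf\{|x-y-z| : z \in \mathbb{Z}^d\}$, where $|\cdot|$ is the Euclidean norm. (The letter $d$ denotes the dimension; $d(\cdot,\cdot)$ denotes the metric.) The connection function $g:[0,\infty)\to[0,1]$ is non-increasing with $0 < \alpha := \int_{\mathbb{R}^d} g(|x|)\,dx < \infty$. On one probability space $(\Omega,\mathcal{F},P)$ let $X_1,X_2,\ldots$ be independent and uniformly distributed on $S$; let $\{N_n\}_{n\ge1}$ be a non-decreasing sequence of random variables with $N_n$ Poisson of mean $n$; and let $\{U_{ij}\}$ be independent uniform random variables on $[0,1]$; these three families are independent of each other. Set $\mathcal{P}_n = \{X_1,\ldots,X_{N_n}\}$, a Poisson point process of intensity $n$ on $S$. For $r>0$, $G_n(r)$ is the (undirected) graph with vertex set $\mathcal{P}_n$ in which $X_i,X_j\in\mathcal{P}_n$,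 $i<j$, are joined by an edge iff $U_{ij} \le g\left(\frac{d(X_i,X_j)}{r}\right)$. The length of an edge is the toroidal distance between its endpoints; the longest edge length is $0$ if there are no edges (with $\log 0=-\infty$). The almost sure statements refer to this coupled family of graphs. *)

(* Defs.v *)
From HB Require Import structures.
From mathcomp Require Import all_boot all_order all_algebra finmap.
From mathcomp Require Import all_classical all_reals all_analysis.
From mathcomp Require Import lra.

Set Implicit Arguments.
Unset Strict Implicit.
Unset Printing Implicit Defensive.

Import Order.TTheory GRing.Theory Num.Theory.
Import numFieldNormedType.Exports.

Local Open Scope classical_set_scope.
Local Open Scope ring_scope.

Section lebesgue_tuple.
Context {R : realType}.

Let consp n (p : R * n.-tuple R) : n.+1.-tuple R := [tuple of p.1 :: p.2].

Let measurable_consp n : measurable_fun setT (@consp n).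
Proof. by apply: measurable_cons. Qed.

Let uncons n (t : n.+1.-tuple R) : R * n.-tuple R :=
  (thead t, [tuple of behead t]).

Let measurable_uncons n : measurable_fun setT (@uncons n).
Proof.
apply/measurable_fun_pair; last exact: measurable_behead.
exact: measurable_tnth.
Qed.

Let consK n : cancel (@consp n) (@uncons n).
Proof.
by move=> [x t]; rewrite /uncons /consp theadE; congr pair; exact/val_inj.
Qed.

Let unconsK n : cancel (@uncons n) (@consp n).
Proof. by move=> t; rewrite [RHS]tuple_eta. Qed.

Section cons_measure.
Context n (m : {sigma_finite_measure set (n.-tuple R) -> \bar R}).

Definition cons_measure : set (n.+1.-tuple R) -> \bar R :=
  pushforward (lebesgue_measure \x m)%E (@consp n).

Let cons_measure0 : cons_measure set0 = 0%E.
Proof. by rewrite /cons_measure /pushforward preimage_set0 measure0. Qed.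

Let cons_measure_ge0 A : (0 <= cons_measure A)%E.
Proof. by rewrite /cons_measure /pushforward measure_ge0. Qed.

Let cons_measure_sigma_additive : semi_sigma_additive cons_measure.
Proof.
move=> F mF tF mUF; rewrite /cons_measure /pushforward preimage_bigcup.
apply: measure_semi_sigma_additive.
- by move=> k; rewrite -[X in measurable X]setTI; exact: measurable_consp.
- apply/trivIsetP => /= i j _ _ ij; rewrite -preimage_setI.
  by move/trivIsetP : tF => /(_ _ _ Logic.I Logic.I ij) ->; rewrite preimage_set0.
- rewrite -preimage_bigcup -[X in measurable X]setTI.
  exact: measurable_consp.
Qed.

HB.instance Definition _ := isMeasure.Build _ _ _ cons_measure
  cons_measure0 cons_measure_ge0 cons_measure_sigma_additive.

Let cons_measure_sigma_finite : sigma_finite setT cons_measure.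
Proof.
have /sigma_finiteP[F [TF ndF Foo]] := sigma_finiteT (@lebesgue_measure R).
have /sigma_finiteP[G [TG ndG Goo]] := sigma_finiteT m.
exists (fun k => @uncons n @^-1` (F k `*` G k)).
  rewrite -preimage_bigcup; apply/esym/seteqP; split=> // t _.
  have [i _ Fi] : (\bigcup_i F i) (thead t) by rewrite -TF.
  have [j _ Gj] : (\bigcup_i G i) [tuple of behead t] by rewrite -TG.
  exists (maxn i j) => //; split => /=.
    by move: Fi; exact/subsetPset/ndF/leq_maxl.
  by move: Gj; exact/subsetPset/ndG/leq_maxr.
move=> k; have [mF Fk] := Foo k; have [mG Gk] := Goo k; split.
  by rewrite -[X in measurable X]setTI; apply: measurable_uncons => //;
    exact: measurableX.
rewrite /cons_measure /pushforward -comp_preimage.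
rewrite (_ : _ \o _ = id); last by apply/funext => p /=; rewrite consK.
by rewrite product_measure1E// lte_mul_pinfty// ge0_fin_numE.
Qed.

HB.instance Definition _ := Measure_isSigmaFinite.Build _ _ _ cons_measure
  cons_measure_sigma_finite.

End cons_measure.

(* R^n is n.-tuple R, whose library sigma-algebra is the product one. *)
Fixpoint lebesgue_tuple n : {sigma_finite_measure set (n.-tuple R) -> \bar R} :=
  match n with
  | 0 => \d_([tuple] : 0.-tuple R)
  | k.+1 => cons_measure (lebesgue_tuple k)
  end.

Lemma lebesgue_tuple_box n (A : 'I_n -> set R) : (forall i, measurable (A i)) ->
  lebesgue_tuple n [set x | forall i, A i (tnth x i)] =
  (\prod_(i < n) lebesgue_measure (A i))%E.
Proof.
elim: n A => [|n IH] A mA /=.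
  by rewrite big_ord0 diracE mem_set//= => -[].
have mB k (B : 'I_k -> set R) : (forall i, measurable (B i)) ->
    measurable [set x : k.-tuple R | forall i, B i (tnth x i)].
  move=> mB; rewrite (_ : [set x | _] =
      \bigcap_(i in [set: 'I_k]) ((fun x => tnth x i) @^-1` B i)).
    apply: fin_bigcap_measurable => // i _.
    by rewrite -[X in measurable X]setTI; exact: measurable_tnth.
  by apply/seteqP; split=> x /= h i; [move=> _|]; exact: h.
rewrite /cons_measure /pushforward.
rewrite (_ : _ @^-1` _ = A ord0 `*`
    [set x : n.-tuple R | forall i, A (lift ord0 i) (tnth x i)]).
  rewrite product_measure1E; [|exact: mA|exact: (mB n (fun i => A (lift ord0 i)) (fun i => mA _))].
  by rewrite big_ord_recl; congr (_ * _)%E; apply: IH => i; exact: mA.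
apply/seteqP; split=> [[x t] /= h|[x t] /= [h0 h] i].
  split; first exact: (h ord0).
  by move=> i; have := h (lift ord0 i); rewrite tnthS.
by case: (unliftP ord0 i) => [j|] ->; rewrite ?tnthS.
Qed.

End lebesgue_tuple.

Section torus.
Context {R : realType} {d : nat}.
Implicit Types x y : d.-tuple R.

Definition enorm x : R := Num.sqrt (\sum_(i < d) tnth x i ^+ 2).

Definition torus : set (d.-tuple R) :=
  [set x | forall i, - 2^-1 < tnth x i <= 2^-1].

(* Defined for arbitrary points of R^d; it is the toroidal metric on [torus]. *)
Definition tdist x y : R :=
  inf [set enorm [tuple tnth x i - tnth y i - (tnth z i)%:~R | i < d]
      | z in [set: d.-tuple int]].

Lemma lebesgue_torus : lebesgue_tuple d torus = 1%E.
Proof.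
pose I (_ : 'I_d) : set R := `]- 2^-1, 2^-1]%classic.
have -> : torus = [set x | forall i, I i (tnth x i)].
  by apply/seteqP; split=> x /= h i; have := h i; rewrite /I /= in_itv.
rewrite lebesgue_tuple_box; last by move=> i; exact: measurable_itv.
rewrite big1// => i _; rewrite lebesgue_measure_itv/= lte_fin ifT; last first.
  by rewrite gtrN ?invr_gt0.
by rewrite -EFinD opprK; congr EFin; lra.
Qed.

End torus.

Section independence.
Context {disp} {T : measurableType disp} {R : realType} (P : probability T R).

(* The sigma-algebra generated by the X i, i in D. *)
Definition sigma_family d' (T' : measurableType d') (I : Type) (D : set I)
    (X : I -> {RV P >-> T'}) : set_system T :=
  <<s \bigcup_(i in D) preimage_set_system setT (X i) measurable >>.

Definition independent_RVs d' (T' : measurableType d') (I : choiceType)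
    (D : set I) (X : I -> {RV P >-> T'}) : Prop :=
  forall (J : {fset I}) (A : I -> set T'), [set` J] `<=` D ->
    (forall i, i \in J -> measurable (A i)) ->
    P (\bigcap_(i in [set` J]) (X i @^-1` A i)) =
    (\prod_(i <- J) P (X i @^-1` A i))%E.

(* For sigma-algebras (which contain setT), this product rule is the mutual
   independence of the three. *)
Definition independent3 (F G H : set_system T) : Prop :=
  forall A B C, F A -> G B -> H C ->
    P (A `&` B `&` C) = (P A * P B * P C)%E.

End independence.

Section graph.
Context {disp} {T : measurableType disp} {R : realType} (P : probability T R).
Context {d : nat} (g : R -> R).
Context (X : nat -> {RV P >-> d.-tuple R}) (N : nat -> {RV P >-> nat})
  (U : nat * nat -> {RV P >-> R}).

(* [X] and [U] are indexed from 0, so that the points of the n-th process are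
   X 0, ..., X (N n - 1); the graph is on the labels of these points. Only the
   [U (i, j)] with i < j matter. *)
Definition link (r : R) (w : T) (i j : nat) : bool :=
  (i < j)%N && (U (i, j) w <= g (tdist (X i w) (X j w) / r)).

Definition edge n (r : R) (w : T) : rel 'I_(N n w) :=
  fun i j => link r w i j || link r w j i.

(* Default 0: the value when there is no edge. *)
Definition longest_edge n (r : R) (w : T) : R :=
  \big[Num.max/0]_(p : 'I_(N n w) * 'I_(N n w) | edge r p.1 p.2)
    tdist (X p.1 w) (X p.2 w).

End graph.

Definition r_hat {R : realType} (d : nat) (alpha gamma : R) (n : nat) : R :=
  (gamma * ln n%:R / (alpha * n%:R)) `^ d%:R^-1.

Lemma r_hatX {R : realType} (d : nat) (alpha gamma : R) (n : nat) :
  (0 < d)%N -> 0 < alpha -> 0 < gamma -> (0 < n)%N ->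
  r_hat d alpha gamma n ^+ d = gamma * ln n%:R / (alpha * n%:R).
Proof.
move=> d0 a0 c0 n0; rewrite /r_hat -powR_mulrn ?powR_ge0// -powRrM.
rewrite mulVf ?pnatr_eq0 -?lt0n// powRr1// divr_ge0//.
  by rewrite mulr_ge0 ?(ltW c0)// ln_ge0// ler1n.
by rewrite mulr_ge0 ?ltW// ltr0n.
Qed.

(* Packaging +oo as a [filter_on] makes the library's [=o_] notation available
   as r -> +oo. *)
Canonical pinfty_filter_on (R : realType) :=
  FilterType (pinfty_nbhs R) _.

Lemma littleo_pinftyP (R : realType) (f e : R -> R) :
  f =o_ (+oo%R) e <->
  forall eps, 0 < eps -> \forall x \near +oo, `|f x| <= eps * `|e x|.
Proof. by split=> [/eqoP//|h]; apply/eqoP. Qed.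

(* Main.v *)
Require Import Defs.
From HB Require Import structures.
From mathcomp Require Import all_boot all_order all_algebra finmap.
From mathcomp Require Import all_classical all_reals all_analysis.
From mathcomp Require Import measurable_realfun ring lra.

Set Implicit Arguments.
Unset Strict Implicit.
Unset Printing Implicit Defensive.

Import Order.TTheory GRing.Theory Num.Theory.
Import numFieldNormedType.Exports.

Local Open Scope classical_set_scope.
Local Open Scope ring_scope.

(** Why the bounds hold.  Let [m = 2 ^ k], and consider all [n] with
    [m <= n < 2 * m] at once.  Almost surely [N n < 8 * m] for all such [n] as
    soon as [k] is large ([ae_poisson_dyadic]), so at most [(8 * m) ^ 2] pairs
    of points are involved.  Fix one pair, at distance [D] and with uniform
    mark [u], and suppose that for some such [n] it is an edge longer than
    [t n], that is, [u <= g (D / r n)] and [t n < D].  When [r] decreases and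
    [t / r] increases, this forces [u <= g (t m / r m)], and
    [u <= g (D / r m)]: the union over [n] costs nothing.

    Now cut the range of [D] at levels [s 0 = t m], [s 1], ..., [s K].  Either
    [s K <= D], and then [u <= g (s K / r m)]; or [D < s l.+1] for a first [l],
    and then [u <= g (s l / r m)] ([link_pair_event]).  On the torus
    [P (D < s) <= (6 * s) ^ d] ([prob_near_pairs]), and [u] is independent of
    [D], so the pair is bad with probability at most a constant times
        sum_(l < K) s l.+1 ^ d * g (s l / r m) + g (s K / r m).
    If this is [O (m ^ - (2 + delta))] for some [delta > 0], the block
    contributes [O (2 ^ - (k * delta))], and the Borel-Cantelli lemma gives
    [longest_edge <= t n] for all large [n], almost surely
    ([longest_edge_eventually_le]).  This crude cutting of the range of [D]
    replaces the integral of [g] outside a ball.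

    It remains to choose the levels.  For [g = o (exp (- c * x))] take
    [t n = (1 + e) / c * r n * ln n] and the single further level [2 * t m];
    then [g (t m / r m) <= m ^ - (1 + e)], while [t m ^ d] is [1 / m] up to
    logarithms.  For [g = o (x ^ - c)] take [t n = n ^ - b] and the levels
    [m ^ (- b + l * eta)]: for small [eta] each term is at most about
    [m ^ ((c - d) * b - c / d)], and this exponent is below [- 2] precisely when
    [b < (c - 2 * d) / (d * (c - d))]. *)

(** * Powers and logarithms *)

Lemma expR1_le4 (R : realType) : expR 1 <= 4 :> R.
Proof.
have h : 2^-1 <= expR (- 2^-1) :> R by apply: le_trans (expR_ge1Dx _); lra.
rewrite -[X in _ <= X]invrK -[X in expR X]opprK expRN.
rewrite lef_pV2 ?posrE ?expR_gt0 ?invr_gt0//.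
have -> : - (1 : R) = 2%:R * - 2^-1 by lra.
rewrite expRM_natl.
by rewrite expr2; nra.
Qed.

Lemma pow2_powR (R : realType) (a : R) k : (2 ^ k)%:R `^ a = (2 `^ a) ^+ k.
Proof. by rewrite -powR_mulrn ?powR_ge0// natrX -powR_mulrn// powRAC. Qed.

Lemma gt1_ltr_powR (R : realType) (a : R) :
  1 < a -> {homo powR a : x y / x < y}.
Proof.
move=> a1 x y xy; have a0 : 0 < a := lt_trans ltr01 a1.
by rewrite /powR gt_eqF// ltr_expR ltr_pM2r// ln_gt0.
Qed.

Section asymptotics.
Context {R : realType}.
Implicit Types (x y a : R) (u : nat -> \bar R).

Lemma limn_esup_le_near u (l : \bar R) :
  (\forall n \near \oo, u n <= l)%E -> (limn_esup u <= l)%E.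
Proof.
move=> ul; rewrite /limn_esup /limf_esup.
apply: le_trans (_ : ereal_sup (u @` [set n | (u n <= l)%E]) <= l)%E.
  by apply: ereal_inf_lbound; exists [set n | (u n <= l)%E].
by apply: ge_ereal_sup => _ [n /= un <-].
Qed.

(** Countably many error terms, so that almost sure bounds can be
    intersected. *)
Lemma lee_addgt0_inv_nat (z : \bar R) (l a : R) : 0 <= a ->
  (forall k : nat, z <= (l + a / k.+1%:R)%:E)%E -> (z <= l%:E)%E.
Proof.
move=> a0 zl; apply/lee_addgt0Pr => e e0.
pose k := Num.bound (a / e).
have ke : a / e < k%:R by apply: archi_boundP; rewrite divr_ge0// ltW.
apply: (le_trans (zl k)); rewrite -EFinD lee_fin lerD2l.
rewrite ler_pdivrMr ?ltr0n// mulrC -ler_pdivrMr// ltW// (lt_trans ke)//.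
by rewrite ltr_nat.
Qed.

Lemma near_powR_ge a y : 0 < a -> \forall n \near \oo, y <= n%:R `^ a.
Proof.
move=> a0; near=> n.
apply: (le_trans (ler_norm y)).
have -> : `|y| = (`|y| `^ a^-1) `^ a by rewrite -powRrM mulVf ?gt_eqF// powRr1.
apply: ge0_ler_powR; rewrite ?nnegrE ?powR_ge0 ?ler0n ?(ltW a0)//.
by near: n; exact: nbhs_infty_ger.
Unshelve. all: by end_near. Qed.

Lemma near_ln_ge y : \forall n \near \oo, y <= ln (n%:R : R).
Proof.
near=> n.
have yn : expR y <= n%:R by near: n; exact: nbhs_infty_ger.
by rewrite -[y]expRK ler_ln// posrE ?expR_gt0// (lt_le_trans (expR_gt0 y)).
Unshelve. all: by end_near. Qed.

Lemma ln_le_powR a x : 0 < a -> 0 < x -> ln x <= a^-1 * x `^ a.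
Proof.
move=> a0 x0; rewrite mulrC ler_pdivlMr// mulrC -ln_powR.
by rewrite ltW// ln_sublinear// powR_gt0.
Qed.

Lemma ln_ge1 n : (3 < n)%N -> 1 <= ln (n%:R : R).
Proof.
move=> n3; rewrite -[leLHS]expRK.
rewrite ler_ln ?posrE ?expR_gt0// ?ltr0n ?(ltn_trans _ n3)//.
by apply: (le_trans (expR1_le4 R)); rewrite ler_nat.
Qed.

(** With [n = m * x], the claim is [ln m + ln x <= x * ln m]; it follows from
    [ln x <= x - 1] and [1 <= ln m]. *)
Lemma ln_div_noninc m n : (3 < m)%N -> (m <= n)%N ->
  ln (n%:R : R) / n%:R <= ln m%:R / m%:R.
Proof.
move=> m3 mn.
have m0 : 0 < m%:R :> R by rewrite ltr0n (ltn_trans _ m3).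
have n0 : 0 < n%:R :> R by rewrite ltr0n (leq_trans _ mn)// (ltn_trans _ m3).
pose x : R := n%:R / m%:R.
have x1 : 1 <= x by rewrite ler_pdivlMr// mul1r ler_nat.
have nE : n%:R = m%:R * x :> R by rewrite mulrC divfK// gt_eqF.
have x0 : 0 < x := lt_le_trans ltr01 x1.
rewrite ler_pdivrMr// mulrAC ler_pdivlMr// nE lnM ?posrE//.
rewrite [m%:R * x]mulrC mulrA ler_pM2r//.
have := ln_ge1 m3; have : ln x <= x - 1.
  by have := @le_ln1Dx R (x - 1); rewrite addrCA subrr addr0; apply; lra.
by move: (ln x) (ln m%:R) => lx lm; nra.
Qed.
End asymptotics.


(** * The toroidal distance *)

Lemma prode_le_expr (R : realDomainType) n (f : 'I_n -> \bar R) (c : R) :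
  (forall i, 0 <= f i)%E -> (forall i, f i <= c%:E)%E ->
  (\prod_(i < n) f i <= (c ^+ n)%:E)%E.
Proof.
elim: n f => [|n IH] f f0 fc; first by rewrite big_ord0 expr0.
rewrite big_ord_recl exprS EFinM lee_pmul ?IH//.
by apply: prode_ge0 => i _.
Qed.

Section torus_distance.
Context {R : realType} {d : nat}.
Implicit Types (x y : d.-tuple R) (s : R).

Lemma enorm_tnth x l : `|tnth x l| <= enorm x.
Proof.
rewrite -sqrtr_sqr /enorm ler_wsqrtr// (bigD1 l)//= lerDl.
by apply: sumr_ge0 => i _; exact: sqr_ge0.
Qed.

Let tdist_nonempty x y :
  [set enorm [tuple tnth x i - tnth y i - (tnth z i)%:~R | i < d]
      | z in [set: d.-tuple int]] !=set0.
Proof. by eexists; exists [tuple 0 | i < d]. Qed.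

Lemma tdistC x y : tdist x y = tdist y x.
Proof.
have sub x' y' :
    [set enorm [tuple tnth x' i - tnth y' i - (tnth z i)%:~R | i < d]
      | z in [set: d.-tuple int]] `<=`
    [set enorm [tuple tnth y' i - tnth x' i - (tnth z i)%:~R | i < d]
      | z in [set: d.-tuple int]].
  move=> _ [z _ <-]; exists [tuple - tnth z i | i < d] => //.
  rewrite /enorm; congr Num.sqrt; apply: eq_bigr => i _.
  rewrite !tnth_mktuple rmorphN/= opprK -sqrrN; congr (_ ^+ 2); lra.
by rewrite /tdist; congr inf; apply/seteqP; split; exact: sub.
Qed.

(** The reals within [s] of [-1], [0] or [1]: coordinates of points of the torus
    differ by less than [1], so no other integer shift can be the best one. *)
Definition near_int s : set R :=
  `[- s, s] `|` `[1 - s, 1 + s] `|` `[-1 - s, -1 + s].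

(** A superset of [tdist x y < s] for points of the torus.  It constrains each
    coordinate separately, hence it is visibly measurable and its sections are
    boxes. *)
Definition near_pairs s : set (d.-tuple R * d.-tuple R) :=
  [set p | forall l, near_int s (tnth p.1 l - tnth p.2 l)].

Lemma tdist_near_pairs x y s : torus x -> torus y -> tdist x y < s ->
  near_pairs s (x, y).
Proof.
move=> tx ty /(inf_lt (tdist_nonempty x y))[_ [z _ <-] zs] l /=.
have {zs} := le_lt_trans (enorm_tnth _ l) zs; rewrite tnth_mktuple.
have := tx l; have := ty l.
move: (tnth x l) (tnth y l) (tnth z l) => a b k /andP[b1 b2] /andP[a1 a2].
rewrite ltr_norml => /andP[l1 l2].
have intle (m n : int) : m <= n -> m%:~R <= n%:~R :> R by rewrite ler_int.
(* A shift with modulus at least 2 is beaten by the shift 0. *)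
have [k1|k1] := leP 2 k.
  have k2 : 2 <= k%:~R :> R by rewrite -[2]/(2%:~R) intle.
  by left; left; rewrite /= in_itv/=; apply/andP; split; lra.
have [k2|k2] := leP k (-2).
  have k3 : k%:~R <= -2 :> R by rewrite -[-2]/((-2)%:~R) intle.
  by left; left; rewrite /= in_itv/=; apply/andP; split; lra.
have : k \in [:: -1; 0; 1].
  by move: k1 k2; rewrite !inE; case: k {l1 l2} => [[|[|n]]|[|[|n]]].
rewrite !inE => /or3P[] /eqP ek; move: l1 l2; rewrite ek /= => l1 l2.
- by right; rewrite /= in_itv/=; apply/andP; split; lra.
- by left; left; rewrite /= in_itv/=; apply/andP; split; lra.
- by left; right; rewrite /= in_itv/=; apply/andP; split; lra.
Qed.

Lemma measurable_near_int s : measurable (near_int s).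
Proof. by apply: measurableU => //; exact: measurableU. Qed.

Lemma measurable_near_pairs s : measurable (near_pairs s).
Proof.
rewrite (_ : near_pairs s = \bigcap_(l in [set: 'I_d])
    ((fun p : d.-tuple R * d.-tuple R => tnth p.1 l - tnth p.2 l)
       @^-1` near_int s)); last first.
  by apply/seteqP; split=> p /= h l; [move=> _|]; exact: h.
apply: fin_bigcap_measurable => // l _.
rewrite -[X in measurable X]setTI; apply: measurable_funB => //.
- exact: (measurableT_comp (@measurable_tnth _ R d l)).
- exact: (measurableT_comp (@measurable_tnth _ R d l)).
- exact: measurable_near_int.
Qed.

Lemma lebesgue_near_int (a s : R) : 0 < s ->
  (lebesgue_measure [set b : R | near_int s (a - b)%R] <= (6 * s)%:E)%E.
Proof.
move=> s0; pose I (c : R) : set R := `[a + c - s, a + c + s]%classic.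
have mI c : measurable (I c) by exact: measurable_itv.
have lI c : (lebesgue_measure (I c) <= (2 * s)%:E)%E.
  rewrite lebesgue_measure_itv/= lte_fin ifT; last lra.
  by rewrite -EFinD lee_fin; lra.
have mU : measurable (I 0 `|` I (-1)) := measurableU _ _ (mI 0) (mI (-1)).
rewrite (_ : [set _ | _] = I 0 `|` I (-1) `|` I 1); last first.
  apply/seteqP; split=> b; rewrite /near_int /I /=; rewrite !in_itv/=.
    by move=> [[]|] /andP[? ?]; [left; left|left; right|right];
      apply/andP; split; lra.
  by move=> [[]|] /andP[? ?]; [left; left|left; right|right];
      apply/andP; split; lra.
have U2 := @measureU2 _ _ _ (@lebesgue_measure R).
apply: le_trans (U2 _ _ mU (mI 1)) _.
apply: le_trans (leeD (U2 _ _ (mI 0) (mI (-1))) (lexx _)) _.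
apply: le_trans (leeD (leeD (lI 0) (lI (-1))) (lI 1)) _.
by rewrite -!EFinD lee_fin; lra.
Qed.

Lemma lebesgue_near_section x s : 0 < s ->
  (lebesgue_tuple d (xsection (near_pairs s) x) <= ((6 * s) ^+ d)%:E)%E.
Proof.
move=> s0; pose A l : set R := [set b | near_int s (tnth x l - b)].
rewrite (_ : xsection _ _ = [set y | forall l, A l (tnth y l)]); last first.
  by rewrite xsectionE; apply/seteqP; split.
rewrite lebesgue_tuple_box; last first.
  move=> l; rewrite -[X in measurable X]setTI.
  by apply: measurable_funB => //; exact: measurable_near_int.
apply: prode_le_expr => l; first exact: measure_ge0.
exact: lebesgue_near_int.
Qed.
End torus_distance.

(** * Pairs of independent uniform points *)

Section random_pairs.
Context {R : realType} {disp : measure_display} {T : measurableType disp}.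
Context {P : probability T R}.

Lemma sigma_family_preimage d' (T' : measurableType d') (I : Type) (D : set I)
    (X : I -> {RV P >-> T'}) i (A : set T') :
  D i -> measurable A -> sigma_family D X (X i @^-1` A).
Proof.
move=> Di mA; apply: sub_sigma_algebra; exists i => //.
by exists A => //; rewrite setTI.
Qed.

Lemma sigma_familyT d' (T' : measurableType d') (I : Type) (D : set I)
    (X : I -> {RV P >-> T'}) : sigma_family D X setT.
Proof.
have [s0 sC _] := smallest_sigma_algebra [set: T]
  (\bigcup_(i in D) preimage_set_system setT (X i) measurable).
by rewrite -[X in sigma_family _ _ X]setD0; exact: (sC _ s0).
Qed.

(** Independence of a whole family from another one applies to the distance of
    two of its members only through this membership, which is the measurability
    of the pair for the generated sigma-algebra. *)
Lemma sigma_family_preimage_pair d' (T' : measurableType d') (I : Type)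
    (D : set I) (X : I -> {RV P >-> T'}) i j (B : set (T' * T')) :
  D i -> D j -> measurable B ->
  sigma_family D X ((fun w => (X i w, X j w)) @^-1` B).
Proof.
move=> Di Dj mB.
pose G := \bigcup_(k in D) preimage_set_system [set: T] (X k) measurable.
have mX k : D k -> measurable_fun [set: g_sigma_algebraType G] (X k).
  by move=> Dk _ A mA; rewrite setTI;
    exact: (@sigma_family_preimage _ _ I D X k A Dk mA).
have := measurable_fun_pair (mX _ Di) (mX _ Dj) measurableT mB.
by rewrite setTI.
Qed.

Lemma independent_RVs_pair d' (T' : measurableType d') (I : choiceType)
    (D : set I) (X : I -> {RV P >-> T'}) i j (A B : set T') :
  independent_RVs D X -> D i -> D j -> i != j ->
  measurable A -> measurable B ->
  P (X i @^-1` A `&` X j @^-1` B) = (P (X i @^-1` A) * P (X j @^-1` B))%E.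
Proof.
move=> indX Di Dj ij mA mB.
have := indX [fset i; j]%fset (fun k => if k == i then A else B).
rewrite big_fsetU1/= ?inE// big_seq_fset1 eqxx eq_sym (negbTE ij) => <-.
- congr (P _); apply/seteqP; split=> [w [Xi Xj] k /=|w /= h].
    by rewrite !inE => /orP[]/eqP ->; rewrite ?eqxx// eq_sym (negbTE ij).
  split; first by have := h i; rewrite /= !inE !eqxx; exact.
  by have := h j; rewrite /= !inE !eqxx orbT eq_sym (negbTE ij); exact.
- by move=> k /=; rewrite !inE => /orP[]/eqP ->.
- by move=> k _; case: ifP.
Qed.

Context {d : nat} (X : nat -> {RV P >-> d.-tuple R}).
Hypothesis X_unif : forall i (A : set (d.-tuple R)), measurable A ->
  distribution P (X i) A = lebesgue_tuple d (A `&` torus).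
Hypothesis X_indep : independent_RVs setT X.

Lemma measurable_torus : measurable (@torus R d).
Proof.
rewrite (_ : torus = \bigcap_(l in [set: 'I_d])
    ((fun x : d.-tuple R => tnth x l) @^-1` `]- 2^-1, 2^-1]%classic)).
  apply: fin_bigcap_measurable => // l _.
  by rewrite -[X in measurable X]setTI; apply: measurable_tnth.
apply/seteqP; split=> x /= h l; last by have := h l Logic.I; rewrite /= in_itv.
by move=> _; have := h l; rewrite /= in_itv.
Qed.

(** By independence the joint law of two points is a product measure, and each
    section of [near_pairs s] has measure at most [(6 * s) ^+ d]. *)
Lemma prob_near_pairs i j s : i != j -> 0 < s ->
  (P ((fun w => (X i w, X j w)) @^-1` near_pairs s) <= ((6 * s) ^+ d)%:E)%E.
Proof.
move=> ij s0.
pose XX := (fun w => (X i w, X j w)).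
have mXX : measurable_fun setT XX by exact: measurable_fun_pair.
pose XXm : {mfun T >-> (d.-tuple R * d.-tuple R)%type} :=
  mfun_Sub (mem_set mXX).
have E : (distribution P (X i) \x distribution P (X j))%E (near_pairs s) =
    distribution P XXm (near_pairs s).
  apply: product_measure_unique; last exact: measurable_near_pairs.
  by move=> A B mA mB; exact: (independent_RVs_pair X_indep).
change (distribution P XXm (near_pairs s) <= ((6 * s) ^+ d)%:E)%E.
rewrite -E /product_measure1.
have c0 : (0 <= (6 * s) ^+ d)%R by rewrite exprn_ge0// mulr_ge0// ltW.
apply: (@le_trans _ _
    (\int[distribution P (X i)]_x (cst ((6 * s) ^+ d)%:E x))%E).
  apply: ge0_le_integral => //.
  - exact: measurable_fun_xsection (measurable_near_pairs s).
  - move=> x _ /=.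
    have mS := measurable_xsection x (@measurable_near_pairs R d s).
    rewrite X_unif//; apply: le_trans (lebesgue_near_section x s0).
    apply: le_measure; rewrite ?inE//.
    by apply: measurableI => //; exact: measurable_torus.
by rewrite integral_cst//= probability_setT mule1.
Qed.

Context (U : nat * nat -> {RV P >-> R}).
Hypothesis U_unif : forall i j (A : set R), (i < j)%N -> measurable A ->
  distribution P (U (i, j)) A = uniform_prob (@ltr01 R) A.

Lemma prob_uniform_le i j u : (i < j)%N -> 0 <= u ->
  (P (U (i, j) @^-1` `]-oo, u]) <= u%:E)%E.
Proof.
move=> ij u0.
have -> : P (U (i, j) @^-1` `]-oo, u]) = uniform_prob (@ltr01 R) `]-oo, u].
  by rewrite -(U_unif ij).
rewrite /uniform_prob integral_uniform_pdf.
rewrite (eq_integral (cst 1%E)); last first.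
  move=> x; rewrite inE/= => -[_]; rewrite in_itv/= /uniform_pdf => ->.
  by rewrite subr0 invr1.
rewrite integral_cst//=; last exact: measurableI.
rewrite mul1e (@le_trans _ _ (lebesgue_measure `[0, u]%classic))//.
  apply: le_measure; rewrite ?inE//; first exact: measurableI.
  by move=> x /= []; rewrite !in_itv/= => -> /andP[-> _].
rewrite lebesgue_measure_itv/= lte_fin.
by case: ifPn => _; rewrite ?oppr0 ?adde0// lee_fin.
Qed.

End random_pairs.

(** * The Borel-Cantelli lemma and the Poisson tail *)

Section borel_cantelli.
Context {R : realType} {disp : measure_display} {T : measurableType disp}.
Context {P : probability T R}.

Lemma geometric_eseries_lty (A q : R) : 0 <= A -> 0 <= q < 1 ->
  (\sum_(k <oo) (A * q ^+ k)%:E < +oo)%E.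
Proof.
move=> A0 /andP[q0 q1].
have cv : cvgn (series (geometric A q)).
  by apply: is_cvg_geometric_series; rewrite ger0_norm.
rewrite (_ : limn _ = (limn (series (geometric A q)))%:E) ?ltry//.
rewrite -EFin_lim//; apply/congr_lim/funext => n /=.
by rewrite /series/= -sumEFin.
Qed.

Lemma borel_cantelli_geometric (F : nat -> set T) (A q : R) :
  (forall k, measurable (F k)) -> 0 <= A -> 0 <= q < 1 ->
  (\forall k \near \oo, P (F k) <= (A * q ^+ k)%:E)%E ->
  {ae P, forall w, \forall k \near \oo, ~ F k w}.
Proof.
move=> mF A0 q01 [n0 _ PF].
exists (lim_sup_set (fun k => F (k + n0)%N)); split.
- apply: bigcapT_measurable => n.
  by apply: bigcup_measurable => k _; exact: mF.
- apply: lim_sup_set_cvg0 => //.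
  apply: le_lt_trans (geometric_eseries_lty A0 q01).
  apply: lee_nneseries => [k _ _|k _]; first exact: measure_ge0.
  apply: (le_trans (PF _ (leq_addl _ _))).
  case/andP: q01 => q0 q1.
  by rewrite lee_fin ler_wpM2l// ler_wiXn2l ?leq_addr// ltW.
- move=> w /= nF n _; apply: contrapT => nk; apply: nF.
  exists (n + n0)%N => // k /= nk' Fk; apply: nk.
  exists (k - n0)%N; first by
    rewrite /= leq_subRL ?(leq_trans (leq_addl _ _) nk')// addnC.
  by rewrite subnK// (leq_trans (leq_addl _ _) nk').
Qed.

Lemma prob_bigcup_le (A : nat -> set T) n (b : nat -> R) :
  (forall i, (i < n)%N -> measurable (A i)) ->
  (forall i, (i < n)%N -> P (A i) <= (b i)%:E)%E ->
  (P (\bigcup_(i < n) A i) <= (\sum_(i < n) b i)%:E)%E.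
Proof.
move=> mA PA; rewrite bigcup_mkord; apply: (le_trans (le_mu_bigsetU _ mA)).
by rewrite -sumEFin; apply: lee_sum => i _; exact: PA.
Qed.
End borel_cantelli.

(** Chernoff's bound at the level of mass functions:
    [2 ^ k * poisson_pmf M k = exp M * poisson_pmf (2 * M) k], so the tail
    beyond [4 * M] is at most [exp M / 2 ^ (4 * M) <= (4 / 16) ^ M]. *)
Lemma poisson_tail (R : realType) (mu : {measure set nat -> \bar R}) (M : nat) :
  (0 < M)%N ->
  (forall k, mu [set k] = (poisson_pmf M%:R k)%:E) ->
  (mu [set k | (4 * M <= k)%N] <= (2^-1 ^+ M)%:E)%E.
Proof.
move=> M0 muE; set D := [set k | _].
have bc (nu : {measure set nat -> \bar R}) :
    nu D = (\sum_(k <oo | k \in D) nu [set k])%E.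
  rewrite -measure_bigcup//; last by move=> i j _ _ [k [/= <- <-]].
  by congr (nu _); apply/seteqP; split=> [k Dk|k [j Dj ->]//]; exists k.
have M0' : 0 < M%:R :> R by rewrite ltr0n.
pose M2 : R := 2 * M%:R.
have M20 : 0 < M2 by rewrite mulr_gt0.
have pE k : poisson_prob M2 k [set k] = (poisson_pmf M2 k)%:E.
  by rewrite /poisson_prob M20 esum_set1// lee_fin poisson_pmf_ge0.
rewrite bc.
pose nu : {measure set nat -> \bar R} := poisson_prob M2 0.
have pE' k : nu [set k] = (poisson_pmf M2 k)%:E := pE k.
have -> : 2^-1 ^+ M = 2^-1 ^+ M * 1 :> R by rewrite mulr1.
apply: (@le_trans _ _ (\sum_(k <oo | k \in D) (2^-1 ^+ M)%:E * nu [set k])%E).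
  apply: lee_nneseries => [k _ _|k]; first exact: measure_ge0.
  rewrite inE /D /= => Mk; rewrite pE' muE -EFinM lee_fin /poisson_pmf M0' M20.
  rewrite /M2 exprMn.
  set a := M%:R ^+ k; set b := _^-1.
  have a0 : 0 <= a by rewrite exprn_ge0// ltW.
  have b0 : 0 <= b by rewrite invr_ge0.
  have ab0 : 0 <= a * b * expR (- (2 * M%:R)) by rewrite !mulr_ge0// expR_ge0.
  have -> : a * b * expR (- M%:R) = expR M%:R * (a * b * expR (- (2 * M%:R))).
    by rewrite mulrCA -expRD; congr (_ * expR _); lra.
  have -> : 2^-1 ^+ M * (2 ^+ k * a * b * expR (- (2 * M%:R))) =
    2^-1 ^+ M * 2 ^+ k * (a * b * expR (- (2 * M%:R))) by rewrite !mulrA.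
  apply: ler_wpM2r => //.
  rewrite -[M%:R]mulr1 expRM_natl.
  apply: (@le_trans _ _ (4 ^+ M)); first by
    rewrite lerXn2r ?nnegrE ?expR_ge0 ?expR1_le4.
  apply: (@le_trans _ _ (2^-1 ^+ M * 2 ^+ (4 * M))); last first.
    by rewrite ler_wpM2l ?exprn_ge0// ler_eXn2l// ltr1n.
  rewrite exprM -exprMn lerXn2r ?nnegrE//; lra.
rewrite nneseriesZl; last by move=> k _; exact: measure_ge0.
rewrite EFinM lee_wpmul2l ?lee_fin ?exprn_ge0//.
rewrite -bc -(@probability_setT _ _ _ (poisson_prob M2 0)).
by apply: le_measure; rewrite ?inE.
Qed.

(** * The connection radius *)

Section connection_radius.
Context {R : realType} (d : nat) (alpha gamma : R).
Hypotheses (d0 : (0 < d)%N) (alpha0 : 0 < alpha) (gamma0 : 0 < gamma).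
Local Notation r := (r_hat d alpha gamma).

Lemma r_hat_gt0 n : (3 < n)%N -> 0 < r n.
Proof.
move=> n3; apply: powR_gt0; rewrite divr_gt0// mulr_gt0//.
  exact: lt_le_trans ltr01 (ln_ge1 n3).
by rewrite ltr0n (ltn_trans _ n3).
Qed.

Lemma r_hat_noninc m n : (3 < m)%N -> (m <= n)%N -> r n <= r m.
Proof.
move=> m3 mn; have n3 := leq_trans m3 mn.
have E k : gamma * ln k%:R / (alpha * k%:R) = gamma / alpha * (ln k%:R / k%:R).
  by rewrite invfM mulrACA.
have ge0 k : (3 < k)%N -> 0 <= gamma / alpha * (ln k%:R / k%:R).
  move=> k3; rewrite mulr_ge0 ?divr_ge0 ?(ltW alpha0) ?(ltW gamma0) ?ler0n//.
  exact: le_trans ler01 (ln_ge1 k3).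
rewrite /r_hat !E; apply: ge0_ler_powR; rewrite ?nnegrE ?invr_ge0 ?ge0//.
by rewrite ler_wpM2l ?ln_div_noninc// divr_ge0 ?ltW.
Qed.

(** The logarithm in [r_hat] is absorbed into an arbitrarily small power. *)
Lemma r_hat_le_powR delta : 0 < delta ->
  exists2 C : R, 0 < C &
    forall n, (0 < n)%N -> r n <= C * n%:R `^ (- d%:R^-1 + delta).
Proof.
move=> delta0; have d0' : 0 < d%:R :> R by rewrite ltr0n.
pose e := d%:R * delta.
have e0 : 0 < e by rewrite mulr_gt0.
pose B := gamma / alpha / e.
have B0 : 0 < B by rewrite !divr_gt0.
exists (B `^ d%:R^-1) => [|n n0]; first exact: powR_gt0.
have n0' : 0 < n%:R :> R by rewrite ltr0n.
have -> : B `^ d%:R^-1 * n%:R `^ (- d%:R^-1 + delta) =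
    (B * n%:R `^ (e - 1)) `^ d%:R^-1.
  rewrite powRM ?powR_ge0 ?ltW// -powRrM; congr (_ * n%:R `^ _).
  by rewrite /e; field; rewrite gt_eqF.
apply: ge0_ler_powR; rewrite ?nnegrE ?invr_ge0 ?ler0n//.
- rewrite divr_ge0 ?mulr_ge0 ?(ltW gamma0) ?(ltW alpha0) ?ler0n//.
  by rewrite ln_ge0// ler1n.
- by rewrite mulr_ge0 ?powR_ge0 ?ltW.
rewrite powRB; last by rewrite (gt_eqF n0') implybT.
rewrite powRr1 ?(ltW n0')// /B.
rewrite (_ : gamma / alpha / e * (n%:R `^ e / n%:R) =
   gamma / (alpha * n%:R) * (e^-1 * n%:R `^ e)); last first.
  by field; rewrite !gt_eqF.
by rewrite [leLHS]mulrAC ler_pM2l ?ln_le_powR// divr_gt0 ?mulr_gt0.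
Qed.
End connection_radius.

(** * Long edges in dyadic blocks *)

Section dyadic_blocks.
Context {R : realType} {d : nat} (g : R -> R).
Hypothesis g01 : forall r, 0 <= r -> 0 <= g r <= 1.
Hypothesis g_noninc : forall r s, 0 <= r -> r <= s -> g s <= g r.
Context {disp : measure_display} {T : measurableType disp}.
Context {P : probability T R}.
Context (X : nat -> {RV P >-> d.-tuple R}) (N : nat -> {RV P >-> nat})
  (U : nat * nat -> {RV P >-> R}).
Hypothesis X_unif : forall i (A : set (d.-tuple R)), measurable A ->
  distribution P (X i) A = lebesgue_tuple d (A `&` torus).
Hypothesis X_indep : independent_RVs setT X.
Hypothesis N_poisson : forall n k, (1 <= n)%N ->
  distribution P (N n) [set k] = (poisson_pmf n%:R k)%:E.
Hypothesis N_nondec :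
  forall m n w, (1 <= m)%N -> (m <= n)%N -> (N m w <= N n w)%N.
Hypothesis U_unif : forall i j (A : set R), (i < j)%N -> measurable A ->
  distribution P (U (i, j)) A = uniform_prob (@ltr01 R) A.
Hypothesis XNU_indep : independent3 P (sigma_family setT X)
  (sigma_family [set n | (1 <= n)%N] N)
  (sigma_family [set p | (p.1 < p.2)%N] U).

Lemma ae_torus : {ae P, forall w, forall i, torus (X i w)}.
Proof.
apply: ae_foralln => i; exists (X i @^-1` ~` torus); split => //.
  by rewrite -[X in measurable X]setTI; apply: measurable_funPT => //;
    exact: measurableC measurable_torus.
have mC : measurable (~` @torus R d) := measurableC measurable_torus.
by have := X_unif i mC; rewrite setICl measure0.
Qed.

(** By monotonicity of [N], the value at [2 ^ k.+1] controls the whole block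
    [2 ^ k <= n < 2 ^ k.+1]. *)
Lemma ae_poisson_dyadic :
  {ae P, forall w, \forall k \near \oo, (N (2 ^ k.+1) w < 8 * 2 ^ k)%N}.
Proof.
have h : {ae P, forall w, \forall k \near \oo,
    ~ (N (2 ^ k.+1) @^-1` [set j | (4 * 2 ^ k.+1 <= j)%N]) w}.
  apply: (@borel_cantelli_geometric _ _ _ P _ 1 2^-1) => //.
  - by move=> k; rewrite -[X in measurable X]setTI; exact: measurable_funPT.
  - lra.
  - apply: nearW => k; rewrite mul1r.
    have M0 : (0 < 2 ^ k.+1)%N by rewrite expn_gt0.
    apply: le_trans (@poisson_tail R (distribution P (N (2 ^ k.+1))) _ M0 _) _.
      by move=> j; exact: N_poisson.
    rewrite lee_fin; apply: ler_wiXn2l; [lra|lra|].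
    by apply: leq_trans (ltnW (ltn_expl k (isT : 1 < 2)%N)) _;
      rewrite leq_exp2l.
move: h; apply: filterS => w; apply: filterS => k /= /negP; rewrite -ltnNge.
by rewrite expnS mulnA.
Qed.

Lemma prob_pairs_le (E : nat -> nat -> set T) (b : R) (M : nat) : 0 <= b ->
  (forall i j, measurable (E i j)) ->
  (forall i j, (i < j)%N -> P (E i j) <= b%:E)%E ->
  (P (\bigcup_(j < M) \bigcup_(i < j) E i j) <= ((M * M)%:R * b)%:E)%E.
Proof.
move=> b0 mE PE.
have -> : (M * M)%:R * b = \sum_(j < M) M%:R * b.
  by rewrite sumr_const card_ord natrM -mulrA mulr_natl.
apply: (@prob_bigcup_le _ _ _ P _ _ (fun=> M%:R * b)) => j jM.
  by apply: bigcup_measurable.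
apply: (@le_trans _ _ (\sum_(i < j) b)%:E).
  by apply: (@prob_bigcup_le _ _ _ P _ _ (fun=> b)) => // i ij; exact: PE.
rewrite sumr_const card_ord lee_fin -[b *+ j]mulr_natl ler_wpM2r// ler_nat.
exact: ltnW.
Qed.

(** What is left of a long edge between [i] and [j] after the range of the
    distance has been cut at the levels [s]: the [u k] bound the connection
    function on the successive ranges, [u K] beyond the last level. *)
Definition pair_event (K : nat) (s u : nat -> R) (i j : nat) : set T :=
  (\bigcup_(k < K) ((fun w => (X i w, X j w)) @^-1` near_pairs (s k) `&`
                  U (i, j) @^-1` `]-oo, u k])) `|`
  U (i, j) @^-1` `]-oo, u K].

Lemma measurable_pair_event K s u i j : measurable (pair_event K s u i j).
Proof.
have mU (a : R) : measurable (U (i, j) @^-1` `]-oo, a]).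
  by rewrite -[X in measurable X]setTI; exact: measurable_funPT.
apply: measurableU => //; apply: bigcup_measurable => k _.
apply: measurableI => //; rewrite -[X in measurable X]setTI.
by apply: measurable_fun_pair => //; exact: measurable_near_pairs.
Qed.

Lemma prob_pair_event K s u i j : (i < j)%N ->
  (forall k, 0 < s k) -> (forall k, 0 <= u k) ->
  (P (pair_event K s u i j) <=
   (6 ^+ d * (\sum_(k < K) s k ^+ d * u k + u K))%:E)%E.
Proof.
move=> ij s0 u0.
have mU (a : R) : measurable (U (i, j) @^-1` `]-oo, a]).
  by rewrite -[X in measurable X]setTI; exact: measurable_funPT.
have mX a : measurable ((fun w => (X i w, X j w)) @^-1` near_pairs a).
  rewrite -[X in measurable X]setTI.
  by apply: measurable_fun_pair => //; exact: measurable_near_pairs.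
apply: le_trans (measureU2 _ _ (mU _)) _.
  by apply: bigcup_measurable => k _; exact: measurableI.
have -> : (6 ^+ d * (\sum_(k < K) s k ^+ d * u k + u K) =
    \sum_(k < K) (6 * s k) ^+ d * u k + 6 ^+ d * u K)%R.
  rewrite mulrDr mulr_sumr; congr (_ + _); apply: eq_bigr => k _.
  by rewrite exprMn mulrA.
rewrite EFinD; apply: leeD.
  apply: (@prob_bigcup_le _ _ _ P _ _ (fun k => (6 * s k) ^+ d * u k)) => k kK.
    exact: measurableI.
  have sX : sigma_family setT X
      ((fun w => (X i w, X j w)) @^-1` near_pairs (s k)).
    by apply: sigma_family_preimage_pair => //; exact: measurable_near_pairs.
  have sU : sigma_family [set p | (p.1 < p.2)%N] U
      (U (i, j) @^-1` `]-oo, u k]) by exact: sigma_family_preimage.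
  have sN : sigma_family [set n | (1 <= n)%N] N setT by exact: sigma_familyT.
  have /= := XNU_indep sX sN sU.
  rewrite setIT probability_setT mule1 => ->.
  rewrite EFinM; apply: lee_pmul; rewrite ?measure_ge0//.
    by apply: prob_near_pairs; rewrite ?neq_ltn ?ij.
  exact: prob_uniform_le.
apply: (le_trans (prob_uniform_le U_unif ij (u0 K))).
by rewrite lee_fin ler_peMl// exprn_ege1// ler1n.
Qed.

(** Here [rho'] stands for the radius at the start of a block and [rho] for
    the one at a later time, whose threshold is [t].  Going up the levels,
    either the distance lies below the next level, or it is large enough for
    the bound on the mark to improve. *)
Lemma link_pair_event (K : nat) (s : nat -> R) (r rho rho' t : R) i j w :
  0 < r -> r <= rho -> rho <= rho' -> 0 <= t ->
  (forall k, 0 < s k) -> s 0%N / rho' <= t / rho ->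
  torus (X i w) -> torus (X j w) ->
  link g X U r w i j -> t < tdist (X i w) (X j w) ->
  pair_event K (fun k => s k.+1) (fun k => g (s k / rho')) i j w.
Proof.
move=> r0 rrho rhorho' t0 s0 st Ti Tj /andP[ij Ug] tD.
set D := tdist _ _ in Ug tD.
have rho0 : 0 < rho := lt_le_trans r0 rrho.
have rho'0 : 0 < rho' := lt_le_trans rho0 rhorho'.
have D0 : 0 < D := le_lt_trans t0 tD.
have Urho : U (i, j) w <= g (D / rho).
  apply: (le_trans Ug); apply: g_noninc; first by rewrite divr_ge0 ?ltW.
  by rewrite ler_pM2l// lef_pV2.
(* After [k] steps the mark is at most [g (s k / rho')], unless the event has
   already occurred. *)
have sub k : (k <= K)%N ->
  (\bigcup_(l < K) ((fun w => (X i w, X j w)) @^-1` near_pairs (s l.+1) `&`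
       U (i, j) @^-1` `]-oo, g (s l / rho')])) w \/
  U (i, j) w <= g (s k / rho').
  elim: k => [_|k IH kK].
    right; apply: (le_trans Urho); apply: g_noninc.
      by rewrite divr_ge0 ?ltW.
    by apply: (le_trans st); rewrite ler_wpM2r ?invr_ge0 ?ltW.
  have [?|Uk] := IH (ltnW kK); first by left.
  have [Ds|sD] := ltP D (s k.+1).
    left; exists k => //; split => /=; last by rewrite in_itv.
    exact: tdist_near_pairs.
  right; apply: (le_trans Urho); apply: g_noninc.
    by rewrite divr_ge0 ?ltW.
  by apply: ler_pM => //; rewrite ?lef_pV2// ?invr_ge0 ltW.
have [?|UK] := sub K (leqnn K); first by left.
by right; rewrite /= in_itv.
Qed.

(** The almost sure bound is reduced to one estimate per block.  The radius [r]
    may be replaced by a larger [rho] that is easier to compute with.  The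
    exponent [2 + delta] is what [(8 * m) ^ 2] pairs require for
    the series over the blocks [m = 2 ^ k] to converge. *)
Lemma longest_edge_eventually_le (r rho t : nat -> R) (K n0 : nat)
    (s : nat -> nat -> R) (A delta : R) :
  (forall n, (n0 <= n)%N -> 0 < r n <= rho n) ->
  (forall n, (n0 <= n)%N -> 0 <= t n) ->
  (forall m n, (n0 <= m <= n)%N -> rho n <= rho m) ->
  (forall m n, (n0 <= m <= n)%N -> s m 0%N / rho m <= t n / rho n) ->
  (forall m k, (n0 <= m)%N -> 0 < s m k) ->
  0 <= A -> 0 < delta ->
  (\forall m \near \oo,
    \sum_(l < K) s m l.+1 ^+ d * g (s m l / rho m) + g (s m K / rho m)
      <= A * m%:R `^ (- (2 + delta))) ->
  {ae P, forall w, \forall n \near \oo,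
     longest_edge g X N U n (r n) w <= t n}.
Proof.
move=> r_rho t0 rho_noninc st s0 A0 delta0 bnd.
pose E m i j :=
  pair_event K (fun k => s m k.+1) (fun k => g (s m k / rho m)) i j.
(* The same event serves for every [n >= 2 ^ k] whose points all have labels
   below [8 * 2 ^ k]. *)
pose F k := \bigcup_(j < 8 * 2 ^ k) \bigcup_(i < j) E (2 ^ k)%N i j.
have mF k : measurable (F k).
  apply: bigcup_measurable => j _; apply: bigcup_measurable => i _.
  exact: measurable_pair_event.
have n0_near : \forall k \near \oo, (n0 <= 2 ^ k)%N.
  exists n0 => // k /= nk.
  by rewrite (leq_trans nk)// ltnW// ltn_expl.
pose block k := \sum_(l < K) s (2 ^ k)%N l.+1 ^+ d *
    g (s (2 ^ k)%N l / rho (2 ^ k)%N) + g (s (2 ^ k)%N K / rho (2 ^ k)%N).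
pose q : R := 2 `^ (- delta).
have q01 : 0 <= q < 1.
  by rewrite powR_ge0 -[ltRHS](powRr0 2) gt1_ltr_powR ?ltr1n// oppr_lt0.
have bnd' : \forall k \near \oo, 4 ^+ k * block k <= A * q ^+ k.
  have [m0 _ Hm] := bnd; exists m0 => // k /= mk.
  have mk2 : (m0 <= 2 ^ k)%N by rewrite (leq_trans mk)// ltnW// ltn_expl.
  have -> : A * q ^+ k = 4 ^+ k * (A * (2 ^ k)%:R `^ (- (2 + delta))).
    have -> : (2 ^ k)%:R `^ (- (2 + delta)) = 4^-1 ^+ k * q ^+ k :> R.
      rewrite pow2_powR opprD powRD ?pnatr_eq0 ?implybT// exprMn.
      by rewrite (powR_invn 2)// -natrX.
    by rewrite [RHS]mulrCA; congr (A * _);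
      rewrite mulrA -exprMn mulfV// expr1n mul1r.
  by rewrite ler_wpM2l ?exprn_ge0//; exact: Hm.
have PF : (\forall k \near \oo, P (F k) <= (64 * 6 ^+ d * A * q ^+ k)%:E)%E.
  near=> k.
  have nk : (n0 <= 2 ^ k)%N by near: k.
  have rho0 : 0 < rho (2 ^ k)%N.
    by have /andP[/lt_le_trans] := r_rho _ nk; apply.
  have g0 l : 0 <= g (s (2 ^ k)%N l / rho (2 ^ k)%N).
    by have /andP[] := g01 (divr_ge0 (ltW (s0 _ l nk)) (ltW rho0)).
  have e0 : 0 <= block k.
    rewrite addr_ge0// sumr_ge0// => l _.
    by rewrite mulr_ge0// exprn_ge0// ltW// s0.
  have ke : 4 ^+ k * block k <= A * q ^+ k by near: k.
  have PE i j : (i < j)%N ->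
      (P (E (2 ^ k)%N i j) <= (6 ^+ d * block k)%:E)%E.
    by move=> ij; apply: prob_pair_event => // l; exact: s0.
  apply: le_trans (prob_pairs_le _ _ _ PE) _.
  - by rewrite mulr_ge0// exprn_ge0.
  - by move=> i j; exact: measurable_pair_event.
  rewrite lee_fin; move: (block k) ke => e ke.
  rewrite (_ : 8 * 2 ^ k * (8 * 2 ^ k) = 64 * 4 ^ k)%N; last first.
    by rewrite mulnACA -expnMn.
  rewrite natrM natrX mulrACA mulrA [leLHS]mulrAC -mulrA -[leRHS]mulrA.
  by rewrite [e * _]mulrC ler_wpM2l// mulr_ge0// exprn_ge0.
have A0' : 0 <= 64 * 6 ^+ d * A by rewrite !mulr_ge0// exprn_ge0.
have bc := borel_cantelli_geometric mF A0' q01 PF.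
apply: filterS3 bc ae_torus ae_poisson_dyadic => w nF Tw Nw.
have [k0 _ Hk] : \forall k \near \oo,
    [/\ ~ F k w, (N (2 ^ k.+1) w < 8 * 2 ^ k)%N & (n0 <= 2 ^ k)%N].
  by near=> k; split; near: k.
exists (2 ^ k0)%N => // n /= kn.
have n_gt0 : (0 < n)%N by rewrite (leq_trans _ kn)// expn_gt0.
pose k := trunc_log 2 n.
have kk : (k0 <= k)%N by exact: trunc_log_max.
have [nFk Nk nk] := Hk _ kk.
have k_le : (2 ^ k <= n)%N by exact: trunc_logP.
have k_lt : (n < 2 ^ k.+1)%N by exact: trunc_log_ltn.
have nn : (n0 <= n)%N := leq_trans nk k_le.
have Nn : (N n w < 8 * 2 ^ k)%N.
  by apply: leq_ltn_trans Nk; apply: N_nondec => //; exact: ltnW.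
have noedge i j : (j < N n w)%N -> link g X U (r n) w i j ->
    tdist (X i w) (X j w) <= t n.
  move=> jN lij; rewrite leNgt; apply/negP => tD; apply: nFk.
  have ij : (i < j)%N by case/andP: lij.
  exists j; first exact: ltn_trans jN Nn.
  exists i => //; have /andP[r0 rrho] := r_rho _ nn.
  apply: (@link_pair_event _ _ (r n) (rho n) _ (t n)) => //.
  - by rewrite rho_noninc// nk.
  - exact: t0.
  - by move=> l; exact: s0.
  - by rewrite st// nk.
rewrite /longest_edge; apply: bigmax_le => [|[i j] /= ]; first exact: t0.
rewrite /edge => /orP[|]; first exact: noedge.
by rewrite tdistC; exact: noedge.
Unshelve. all: by end_near. Qed.
(** * The two decay rates *)

Context (alpha gamma : R).
Hypotheses (d_gt0 : (0 < d)%N) (alpha_gt0 : 0 < alpha) (gamma_gt0 : 0 < gamma).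
Local Notation r := (r_hat d alpha gamma).
Local Notation L n w := (longest_edge g X N U n (r n) w).

(** One level above the threshold suffices: doubling the distance squares the
    exponential, which beats the number of pairs without help from
    the proximity of the points. *)
Lemma longest_edge_expR_decay (c e : R) : 0 < c -> 0 < e ->
  g =o_ (+oo%R) (fun x => expR (- c * x)) ->
  {ae P, forall w, \forall n \near \oo,
    L n w <= (1 + e) / c * (r n * ln n%:R)}.
Proof.
move=> c0 e0 /littleo_pinftyP/(_ 1 ltr01)[x0 [_ gx0]].
have d0 : 0 < d%:R :> R by rewrite ltr0n.
have e1 : 0 < 1 + e by lra.
have : 0 < (1 + e) / c by rewrite divr_gt0.
move kapE : ((1 + e) / c) => kap kap0.
have g_le x n : (3 < n)%N -> x0 < kap * ln n%:R -> kap * ln n%:R <= x ->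
    g x <= expR (- c * x).
  move=> n3 xn nx; apply: le_trans (ler_norm _) _.
  apply: le_trans (gx0 _ (lt_le_trans xn nx)) _.
  by rewrite mul1r ger0_norm ?expR_ge0.
(* Up to constants, the two logarithmic factors of [t m ^+ d] are each bounded
   by [m `^ (d * delta)]; together they cost half of [e]. *)
pose delta := e / (4 * d%:R).
have delta0 : 0 < delta by rewrite divr_gt0// mulr_gt0.
have [C C0 rC] := r_hat_le_powR d_gt0 alpha_gt0 gamma_gt0 delta0.
pose t n := kap * (r n * ln n%:R).
have ln0 n : (3 < n)%N -> 0 < ln (n%:R : R).
  by move=> n3; apply: lt_le_trans ltr01 (ln_ge1 n3).
have t0 n : (3 < n)%N -> 0 < t n.
  move=> n3; apply: mulr_gt0 => //.
  by apply: mulr_gt0; [exact: r_hat_gt0|exact: ln0].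
have sE m (l : R) : (3 < m)%N -> l * t m / r m = l * (kap * ln m%:R).
  by move=> m3; rewrite /t; field; rewrite gt_eqF// r_hat_gt0.
pose B := (2 * kap * C / delta) ^+ d.
have B0 : 0 <= B.
  by apply/exprn_ge0/ltW/divr_gt0 => //; apply/mulr_gt0 => //; exact: mulr_gt0.
apply: (@longest_edge_eventually_le r r t 1 4
  (fun m l => l.+1%:R * t m) (B + 1) (e / 2)).
- by move=> n n3; rewrite r_hat_gt0 ?lexx.
- by move=> n n3; rewrite ltW// t0.
- by move=> m n /andP[m3 mn]; exact: r_hat_noninc.
- move=> m n /andP[m3 mn]; have n3 := leq_trans m3 mn.
  rewrite sE// -[t n]mul1r sE// !mul1r ler_pM2l//.
  by rewrite ler_ln ?ler_nat// posrE ltr0n ?(ltn_trans _ m3)// (ltn_trans _ n3).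
- by move=> m l m3; rewrite mulr_gt0 ?t0// ltr0n.
- lra.
- lra.
near=> m.
have m3 : (3 < m)%N by near: m; exact: nbhs_infty_gt.
have lnm : kap^-1 * x0 + 1 <= ln m%:R by near: m; exact: near_ln_ge.
have m0 : (0 < m)%N by exact: ltn_trans m3.
have m1 : 1 <= m%:R :> R by rewrite ler1n.
have m0' : 0 < m%:R :> R by rewrite ltr0n.
have xm : x0 < kap * ln m%:R.
  by rewrite -ltr_pdivrMl//; apply: lt_le_trans lnm; rewrite ltrDl.
have expE (a : R) :
    expR (- c * (a * (kap * ln m%:R))) = m%:R `^ (- (a * (1 + e))).
  rewrite /powR gt_eqF//; congr expR; rewrite -kapE; field; exact: lt0r_neq0.
rewrite big_ord1 !sE// mul1r.
have g1 : g (kap * ln m%:R) <= m%:R `^ (- (1 + e)).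
  by apply: le_trans (g_le _ _ m3 xm (lexx _)) _;
    rewrite -[kap * _]mul1r expE mul1r.
have g2 : g (2 * (kap * ln m%:R)) <= m%:R `^ (- (2 * (1 + e))).
  rewrite -expE; apply: (g_le _ m) => //; rewrite ler_peMl ?ler1n//.
  by rewrite mulr_ge0 ?ltW// ln0.
have tB : (2 * t m) ^+ d <= B * m%:R `^ (- 1 + e / 2).
  have -> : B * m%:R `^ (- 1 + e / 2) =
      (2 * (kap * (C * m%:R `^ (- d%:R^-1 + delta) *
                   (delta^-1 * m%:R `^ delta)))) ^+ d.
    have -> : 2 * (kap * (C * m%:R `^ (- d%:R^-1 + delta) *
                          (delta^-1 * m%:R `^ delta))) =
        (2 * kap * C / delta) * m%:R `^ (- d%:R^-1 + delta + delta).
      rewrite (@powRD _ _ (- d%:R^-1 + delta)); last first.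
        by rewrite (gt_eqF m0') implybT.
      by rewrite -!mulrA; do 3 congr (_ * _); exact: mulrCA.
    rewrite exprMn; congr (_ * _); rewrite -powR_mulrn ?powR_ge0// -powRrM.
    by congr (_ `^ _); rewrite /delta; field; exact: lt0r_neq0.
  have tC : t m <= kap * (C * m%:R `^ (- d%:R^-1 + delta) *
                          (delta^-1 * m%:R `^ delta)).
    rewrite /t ler_pM2l//; apply: ler_pM; first exact/ltW/r_hat_gt0.
    - exact/ltW/ln0.
    - exact: rC.
    - exact: ln_le_powR.
  have tm0 := t0 m m3.
  apply: lerXn2r; rewrite ?nnegrE; last by rewrite ler_pM2l.
    by rewrite mulr_ge0// ltW.
  by rewrite mulr_ge0//; apply: le_trans tC; exact: ltW.
rewrite [leRHS]mulrDl mul1r; apply: lerD; last first.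
  by apply: (le_trans g2); rewrite ler_powR//; lra.
apply: le_trans (_ : B * m%:R `^ (- 1 + e / 2) * m%:R `^ (- (1 + e)) <= _).
  apply: ler_pM => //; first by rewrite exprn_ge0// mulr_ge0// ltW// t0.
  have /g01/andP[]// : 0 <= kap * ln m%:R by rewrite mulr_ge0 ?ltW ?ln0.
rewrite -mulrA -powRD; last by rewrite (gt_eqF m0') implybT.
by rewrite ler_wpM2l// ler_powR//; lra.
Unshelve. all: by end_near. Qed.

(** A polynomial tail needs several levels, since a fixed factor on the distance
    only gains a fixed factor on [g].  Consecutive levels differ by the factor
    [m `^ eta], and [K] of them lead from [m `^ (- b)] up to distance [1], where
    the last term is about [m `^ (- (c / d))] with [c / d > 2]. *)
Lemma longest_edge_powR_decay (c b : R) : 2 * d%:R < c -> 0 <= b ->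
  b < (c - 2 * d%:R) / (d%:R * (c - d%:R)) ->
  g =o_ (+oo%R) (fun x => x `^ (- c)) ->
  {ae P, forall w, \forall n \near \oo, L n w <= n%:R `^ (- b)}.
Proof.
move=> dc b0 bb /littleo_pinftyP/(_ 1 ltr01)[x0 [_ gx0]].
have d0 : 0 < d%:R :> R by rewrite ltr0n.
have d_neq0 := lt0r_neq0 d0.
have c0 : 0 < c by lra.
have cd0 : 0 < c - d%:R by lra.
have g_le x : 0 < x -> x0 < x -> g x <= x `^ (- c).
  move=> x_gt0 x0x; apply: le_trans (ler_norm _) _.
  apply: le_trans (gx0 _ x0x) _.
  by rewrite mul1r ger0_norm ?powR_ge0.
have := bb; rewrite ltr_pdivlMr ?mulr_gt0// => bb'.
pose e := c / d%:R - 2 - (c - d%:R) * b.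
have e0 : 0 < e.
  rewrite /e subr_gt0 ltrBrDr -(ltr_pM2r d0) divfK// mulrDl; lra.
(* The slack [e] is positive exactly when [b] is below the claimed exponent.
   The spacing of the levels and the logarithm in [r_hat] cost a quarter of it
   each. *)
pose eta := e / (4 * d%:R).
pose delta := e / (4 * c).
have eta0 : 0 < eta by rewrite divr_gt0 ?mulr_gt0.
have delta0 : 0 < delta by rewrite divr_gt0 ?mulr_gt0.
have deta : d%:R * eta = e / 4 by rewrite /eta; field.
have cdelta : c * delta = e / 4 by rewrite /delta; field; exact: lt0r_neq0.
(* The exponent of growth of the rescaled threshold [t m / rho m]. *)
pose theta := d%:R^-1 - delta - b.
have ctheta : c * theta = 2 + e / 4 * 3 - d%:R * b.
  by rewrite /theta !mulrBr cdelta /e; field.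
have db1 : d%:R * b < 1.
  by rewrite -(ltr_pM2r cd0); nra.
have theta0 : 0 < theta by rewrite -(pmulr_rgt0 _ c0) ctheta; lra.
have delta_le : delta <= d%:R^-1 by move: theta0; rewrite /theta; lra.
have [C C0 rC] := r_hat_le_powR d_gt0 alpha_gt0 gamma_gt0 delta0.
pose K := Num.bound (b / eta).
have bK : b <= K%:R * eta.
  by rewrite -ler_pdivrMr// ltW// archi_boundP// divr_ge0// ltW.
pose rho n : R := C * n%:R `^ (- d%:R^-1 + delta).
pose s m l : R := m%:R `^ (- b + l%:R * eta).
have s_rho m l : (0 < m)%N ->
    s m l / rho m = C^-1 * m%:R `^ (theta + l%:R * eta).
  move=> m0; have m0' : m%:R != 0 :> R by rewrite pnatr_eq0 -lt0n.
  rewrite /s /rho invfM mulrCA -powRN -powRD ?m0' ?implybT//.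
  by congr (_ * _ `^ _); rewrite /theta; ring.
apply: (@longest_edge_eventually_le r rho (fun n => n%:R `^ (- b)) K 4 s
  (C `^ c *+ K.+1) (e / 2)).
- by move=> n n3; rewrite r_hat_gt0 ?rC// (leq_trans _ n3).
- by move=> n _; exact: powR_ge0.
- move=> m n /andP[m3 mn]; rewrite /rho ler_pM2l//.
  have -> : - d%:R^-1 + delta = - (d%:R^-1 - delta) by rewrite opprB addrC.
  rewrite !powRN.
  have m0 : (0 < m)%N by exact: leq_trans m3.
  rewrite lef_pV2 ?posrE ?powR_gt0 ?ltr0n// ?(leq_trans m0)//.
  by apply: ge0_ler_powR; rewrite ?nnegrE ?ler0n ?ler_nat ?subr_ge0.
- move=> m n /andP[m3 mn].
  have m0 : (0 < m)%N by exact: leq_trans m3.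
  have n0 : (0 < n)%N by exact: leq_trans mn.
  have -> : n%:R `^ (- b) = s n 0%N by rewrite /s mul0r addr0.
  rewrite !s_rho// mul0r addr0 ler_pM2l ?invr_gt0//.
  by apply: ge0_ler_powR; rewrite ?nnegrE ?ler0n ?ler_nat// ltW.
- by move=> m l m3; rewrite powR_gt0// ltr0n (leq_trans _ m3).
- by rewrite mulrn_wge0// powR_ge0.
- by rewrite divr_gt0.
near=> m.
have m0 : (0 < m)%N by near: m; exact: nbhs_infty_gt.
have m1 : 1 <= m%:R :> R by rewrite ler1n.
have m0' : 0 < m%:R :> R by rewrite ltr0n.
have xm : C * x0 + 1 <= m%:R `^ theta by near: m; exact: near_powR_ge.
have gs l : g (s m l / rho m) <= C `^ c * m%:R `^ (- c * (theta + l%:R * eta)).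
  rewrite s_rho//.
  have -> : C `^ c * m%:R `^ (- c * (theta + l%:R * eta)) =
      (C^-1 * m%:R `^ (theta + l%:R * eta)) `^ (- c).
    rewrite powRM ?invr_ge0 ?powR_ge0 ?(ltW C0)// -[C^-1]powR_inv1 ?(ltW C0)//.
    by rewrite -!powRrM mulrNN mul1r [- c * _]mulrC.
  apply: g_le; first by rewrite mulr_gt0 ?invr_gt0// powR_gt0.
  rewrite -ltr_pdivrMl ?invr_gt0// invrK.
  apply: (@lt_le_trans _ _ (m%:R `^ theta)); first lra.
  by rewrite ler_powR// lerDl mulr_ge0// ltW.
have near_last : C `^ c * m%:R `^ (- c * (theta + K%:R * eta)) <=
    C `^ c * m%:R `^ (- (2 + e / 2)).
  rewrite ler_pM2l ?powR_gt0// ler_powR// mulNr mulrDr ctheta; nra.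
rewrite mulrSr mulrDl; apply: lerD; last exact: le_trans near_last.
rewrite -[X in _ *+ X](card_ord K) -sumr_const mulr_suml.
apply: ler_sum => l _.
apply: le_trans (ler_wpM2l _ (gs l)) _; first by rewrite exprn_ge0// powR_ge0.
rewrite mulrCA ler_pM2l ?powR_gt0// /s -powR_mulrn ?powR_ge0// -powRrM.
rewrite -powRD; last by rewrite (gt_eqF m0') implybT.
apply: ler_powR => //; rewrite mulNr mulrDr ctheta -natr1.
have : 0 <= l%:R * eta * (c - d%:R) by rewrite !mulr_ge0// ltW.
move: deta; move: (l%:R : R) (d%:R : R) => l' d' deta; nra.
Unshelve. all: by end_near. Qed.
End dyadic_blocks.

Theorem proposition2p3 (R : realType) (d : nat) (hd : (2 <= d)%N)
  (g : R -> R)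
  (g01 : forall r, 0 <= r -> 0 <= g r <= 1)
  (g_noninc : forall r s, 0 <= r -> r <= s -> g s <= g r)
  (alpha : R) (alpha_gt0 : 0 < alpha)
  (alphaE : (\int[lebesgue_tuple d]_x (g (enorm x))%:E)%E = alpha%:E)
  (disp : measure_display) (T : measurableType disp) (P : probability T R)
  (X : nat -> {RV P >-> d.-tuple R})
  (X_unif : forall i (A : set (d.-tuple R)), measurable A ->
     distribution P (X i) A = lebesgue_tuple d (A `&` torus))
  (X_indep : independent_RVs setT X)
  (N : nat -> {RV P >-> nat})
  (N_poisson : forall n k, (1 <= n)%N ->
     distribution P (N n) [set k] = (poisson_pmf n%:R k)%:E)
  (N_nondec : forall m n w, (1 <= m)%N -> (m <= n)%N -> (N m w <= N n w)%N)
  (U : nat * nat -> {RV P >-> R})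
  (U_unif : forall i j (A : set R), (i < j)%N -> measurable A ->
     distribution P (U (i, j)) A = uniform_prob (@ltr01 R) A)
  (U_indep : independent_RVs [set p | (p.1 < p.2)%N] U)
  (XNU_indep : independent3 P (sigma_family setT X)
     (sigma_family [set n | (1 <= n)%N] N)
     (sigma_family [set p | (p.1 < p.2)%N] U))
  (gamma : R) (gamma_gt0 : 0 < gamma) :
  let L n w := longest_edge g X N U n (r_hat d alpha gamma n) w in
  (forall c : R, 0 < c -> g =o_ (+oo%R) (fun r => expR (- c * r)) ->
    {ae P, forall w,
      (limn_esup (fun n => (L n w / (r_hat d alpha gamma n * ln n%:R))%:E)
       <= c^-1%:E)%E}) /\
  (forall c : R, 2 * d%:R < c -> g =o_ (+oo%R) (fun r => r `^ (- c)) ->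
    {ae P, forall w,
      (limn_esup (fun n => lne (L n w)%:E / (ln n%:R)%:E)
       <= (- ((c - 2 * d%:R) / (d%:R * (c - d%:R))))%:E)%E}).
Proof.
have d0 : (0 < d)%N by exact: leq_trans hd.
move=> L; split=> c hc glo.
- have h (k : nat) : {ae P, forall w, \forall n \near \oo, L n w <=
      (1 + k.+1%:R^-1) / c * (r_hat d alpha gamma n * ln n%:R)}.
    by apply: longest_edge_expR_decay glo => //; rewrite invr_gt0.
  apply: filterS (ae_foralln h) => w Lw.
  apply: (@lee_addgt0_inv_nat _ _ _ c^-1) => [|k].
    by rewrite invr_ge0 ltW.
  apply: limn_esup_le_near; near=> n.
  have n3 : (3 < n)%N by near: n; exact: nbhs_infty_gt.
  rewrite lee_fin ler_pdivrMr; last first.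
    by rewrite mulr_gt0 ?r_hat_gt0// (lt_le_trans ltr01)// ln_ge1.
  have -> : c^-1 + c^-1 / k.+1%:R = (1 + k.+1%:R^-1) / c.
    by rewrite mulrDl mul1r mulrC.
  by near: n; exact: Lw.
- set beta := (c - 2 * d%:R) / (d%:R * (c - d%:R)).
  have d0' : 0 < d%:R :> R by rewrite ltr0n.
  have beta0 : 0 < beta by rewrite divr_gt0 ?mulr_gt0//; lra.
  have h (k : nat) : {ae P, forall w, \forall n \near \oo,
      L n w <= n%:R `^ (- (beta - beta / k.+1%:R))}.
    apply: longest_edge_powR_decay glo => //.
      rewrite subr_ge0 ler_pdivrMr// ler_peMr ?ler1n//; exact: ltW.
    by rewrite -/beta gtrBl divr_gt0.
  apply: filterS (ae_foralln h) => w Lw.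
  apply: (@lee_addgt0_inv_nat _ _ _ beta) => [|k]; first exact: ltW.
  apply: limn_esup_le_near; near=> n.
  have n3 : (3 < n)%N by near: n; exact: nbhs_infty_gt.
  have ln0 : 0 < ln (n%:R : R) by apply: lt_le_trans (ln_ge1 n3).
  have Ln : L n w <= n%:R `^ (- (beta - beta / k.+1%:R)) by near: n; exact: Lw.
  rewrite inver gt_eqF//.
  have [L0|L0] := leP (L n w) 0.
    by rewrite le0_lneNy ?lee_fin// gt0_mulNye ?leNye// lte_fin invr_gt0.
  rewrite lne_EFin// -EFinM lee_fin ler_pdivrMr//.
  have -> : - beta + beta / k.+1%:R = - (beta - beta / k.+1%:R).
    by rewrite opprB addrC.
  rewrite -ln_powR ler_ln ?posrE//.
  by rewrite powR_gt0// ltr0n (leq_trans _ n3).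
Unshelve. all: by end_near. Qed.
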